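(* Let $\sigma,\ell\in\mathbb{R}$ and let $f:\mathbb{R}^n\to\mathbb{R}\cup\{\infty\}$ be a proper lsc function. Then the following hold. (i) If $f\in\mathcal{F}_\sigma(\mathbb{R}^n)$, i.e. $f$ is $\sigma$-convex, then $\partial f$ is $(\sigma,0)$-semimonotone. (ii) If $f$ is continuous and $f\in\mathcal{F}^\ell(\mathbb{R}^n)$ with $\ell<0$, then $\partial f$ is $(0,\tfrac1\ell)$-semimonotone. (iii) If $f$ is continuous and $f\in\mathcal{F}^\ell(\mathbb{R}^n)$ with $\ell\ge0$, then $\partial f$ is $\big(\alpha(1-c\alpha),\,c\Box\tfrac{1}{\ell-\alpha}\big)$-semimonotone for all $\alpha>\ell$ and $c>\tfrac{1}{\alpha-\ell}$. If $f\in\mathcal{F}^\ell_\sigma(\mathbb{R}^n)$, then $\sigma\le\ell$, $f$ is continuously differentiable, and the following hold. (iv) If $\ell+\sigma>0$, then $\nabla f$ is $\big(\sigma\Box\ell,\tfrac{1}{\ell+\sigma}\big)$-semimonotone. (v) If $\ell+\sigma\le0$, then $\nabla f$ is $\big(\sigma(1-c\sigma),\,c\Box\tfrac{1}{\ell-\sigma}\big)$-semimonotone for any constant $c$ such that $1+c(\ell-\sigma)>0$.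
   Context: $\partial f$ is the limiting subdifferential. $f\in\mathcal{F}_\sigma(\mathbb{R}^n)$ (lower curvature $\sigma$) means $f-\tfrac\sigma2\|\cdot\|^2$ is convex; $f\in\mathcal{F}^\ell(\mathbb{R}^n)$ (upper curvature $\ell$) means $f$ is finite-valued and $\tfrac\ell2\|\cdot\|^2-f$ is convex; $\mathcal{F}_\sigma^\ell(\mathbb{R}^n)=\mathcal{F}_\sigma(\mathbb{R}^n)\cap\mathcal{F}^\ell(\mathbb{R}^n)$. An operator $A:\mathbb{R}^n\rightrightarrows\mathbb{R}^n$ is $(\mu,\rho)$-semimonotone if $\langle x-x',y-y'\rangle\ge\mu\|x-x'\|^2+\rho\|y-y'\|^2$ for all $(x,y),(x',y')$ with $y\in Ax$, $y'\in Ax'$. Parallel sum: $a\Box b=0$ if $a=b=0$, $a\Box b=\frac{ab}{a+b}$ if $a+b\ne0$, and $a\Box\infty=a$; when $\ell=\sigma$, $\tfrac1{\ell-\sigma}$ is read as $\infty$. *)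

(* Defs.v *)
From HB Require Import structures.
From mathcomp Require Import all_boot all_order all_algebra.
From mathcomp Require Import all_classical all_reals all_analysis.

Set Implicit Arguments.
Unset Strict Implicit.
Unset Printing Implicit Defensive.

Import Order.TTheory GRing.Theory Num.Theory.
Import numFieldNormedType.Exports.

Local Open Scope classical_set_scope.
Local Open Scope ring_scope.

(* The library norm on 'rV[R]_n is the sup norm. It is used only through the
   topology and differentiability it induces, which are those of the Euclidean
   norm; every metric expression uses the Euclidean structure below. *)
Definition edot (R : realType) (n : nat) (x y : 'rV[R]_n) : R :=
  \sum_(i < n) x 0 i * y 0 i.

Definition enorm (R : realType) (n : nat) (x : 'rV[R]_n) : R :=
  Num.sqrt (edot x x).

Definition properf (R : realType) (n : nat) (f : 'rV[R]_n -> \bar R) : Prop :=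
  (forall x, (-oo < f x)%E) /\ (exists x, (f x < +oo)%E).

Definition econvex (R : realType) (n : nat) (g : 'rV[R]_n -> \bar R) : Prop :=
  forall (x y : 'rV[R]_n) (t : R), 0 < t -> t < 1 ->
    (g (t *: x + (1 - t) *: y)%R <= t%:E * g x + (1 - t)%:E * g y)%E.

(* The class F_sigma. *)
Definition lower_curvature (R : realType) (n : nat) (sigma : R)
    (f : 'rV[R]_n -> \bar R) : Prop :=
  econvex (fun x => (f x - (sigma / 2 * enorm x ^+ 2)%:E)%E).

(* The class F^ell. *)
Definition upper_curvature (R : realType) (n : nat) (ell : R)
    (f : 'rV[R]_n -> \bar R) : Prop :=
  (forall x, f x \is a fin_num) /\
  econvex (fun x => ((ell / 2 * enorm x ^+ 2)%:E - f x)%E).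

(* The class F_sigma^ell. *)
Definition lower_upper_curvature (R : realType) (n : nat) (sigma ell : R)
    (f : 'rV[R]_n -> \bar R) : Prop :=
  lower_curvature sigma f /\ upper_curvature ell f.

(* Regular (Frechet) subdifferential:
   liminf_(z -> x, z != x) (f z - f x - <v, z - x>) / ||z - x|| >= 0. *)
Definition regular_subdiff (R : realType) (n : nat) (f : 'rV[R]_n -> \bar R)
    (x : 'rV[R]_n) : set 'rV[R]_n :=
  [set v | f x \is a fin_num /\
    (0 <= limf_einf
      (fun z => (f z - f x - (edot v (z - x)%R)%:E) / (enorm (z - x)%R)%:E)
      x^')%E].

(* Limiting (Mordukhovich) subdifferential: limits of regular subgradients
   along f-attentive sequences; empty outside the domain of f. *)
Definition limiting_subdiff (R : realType) (n : nat) (f : 'rV[R]_n -> \bar R)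
    (x : 'rV[R]_n) : set 'rV[R]_n :=
  [set v | f x \is a fin_num /\
    exists (x_ v_ : nat -> 'rV[R]_n),
      [/\ forall k, regular_subdiff f (x_ k) (v_ k),
          x_ k @[k --> \oo] --> x,
          f (x_ k) @[k --> \oo] --> f x &
          v_ k @[k --> \oo] --> v]].

(* Euclidean gradient: the vector representing the differential. *)
Definition gradient (R : realType) (n : nat) (g : 'rV[R]_n -> R)
    (x : 'rV[R]_n) : 'rV[R]_n :=
  \row_(i < n) 'd g x (delta_mx 0 i).

Definition continuously_differentiable (R : realType) (n : nat)
    (g : 'rV[R]_n -> R) : Prop :=
  (forall x, differentiable g x) /\ continuous (gradient g).

Definition semimonotone (R : realType) (n : nat) (mu rho : R)
    (A : 'rV[R]_n -> set 'rV[R]_n) : Prop :=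
  forall x x' y y' : 'rV[R]_n, A x y -> A x' y' ->
    mu * enorm (x - x') ^+ 2 + rho * enorm (y - y') ^+ 2
      <= edot (x - x') (y - y').

(* Parallel sum a [] b for a real and b real or +oo. It is undefined when
   a + b = 0 with a != 0, or b = -oo; these cases get the junk value 0. *)
Definition parallel_sum (R : realType) (a : R) (b : \bar R) : R :=
  match b with
  | r%:E => if a + r == 0 then 0 else a * r / (a + r)
  | +oo%E => a
  | -oo%E => 0
  end.

(* Main.v *)
Require Import Defs.
From HB Require Import structures.
From mathcomp Require Import all_boot all_order all_algebra.
From mathcomp Require Import all_classical all_reals all_analysis.
From mathcomp Require Import ring lra.

Import Order.TTheory GRing.Theory Num.Theory.
Import numFieldNormedType.Exports.

Local Open Scope classical_set_scope.
Local Open Scope ring_scope.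

(** Everything reduces to two-sided quadratic estimates at a point.  Convexity of
    [f - (s/2)|.|^2] is equivalent to a convexity inequality for [f] itself with
    the correction term [(s/2) t (1 - t) |x - y|^2]; the sign of [s] is arbitrary,
    so an upper curvature bound [ell] on [f] is the same inequality for [- f] with
    [s = - ell].  For such a function, a first-order bound at [x] that holds only
    near [x], in the limit along each direction, self-improves to a global
    quadratic minorant: this is [regular_subdiff_lower] for a bound from below,
    and [qconvex_subgrad] for a bound from above, which convexity reflects through
    [x].

    A regular subgradient [v] is a local first-order lower bound for [f].  Under
    lower curvature [sigma] it gives a global minorant of [f] with slope [v]; under
    upper curvature [ell] it is an upper bound for [- f] and gives a global
    minorant of [- f] with slope [- v].  These inequalities are closed under the
    limits that define limiting subgradients.  Adding the inequalities at [x] and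
    [x'] gives (i), and [<x - x', y - y'> <= ell |x - x'|^2] in case (ii), where a
    negative [ell] turns it into the claim after completing a square.  In (iii)
    the two moduli are so negative that the inequality is a positive semidefinite
    quadratic form in [(x - x', y - y')].

    With both bounds, one-dimensional subgradients of [- f] along the axes exist by
    a supremum argument; midpoint convexity of [f] assembles them into a quadratic
    upper bound for [f] in all directions, and two applications of the
    self-improvement make it a pair of global bounds with common slope [v]
    ([qconvex_two_sided]).  Hence [f] is differentiable with gradient [v].  Comparing
    the two bounds at well-chosen points shows that [grad f - sigma id] is
    cocoercive with constant [1 / (ell - sigma)] ([qsubgrad_cocoercive]), from which
    Lipschitz continuity of the gradient, (iv) and (v) follow by algebra. *)

(** * Euclidean inner product *)

Section EuclideanDot.
Context {R : realType} {n : nat}.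
Implicit Types (x y z : 'rV[R]_n) (t : R).

Lemma edotC x y : edot x y = edot y x.
Proof. by apply: eq_bigr => i _; rewrite mulrC. Qed.

Lemma edotDr x y z : edot x (y + z) = edot x y + edot x z.
Proof. by rewrite -big_split/=; apply: eq_bigr => i _; rewrite mxE mulrDr. Qed.

Lemma edotZr t x y : edot x (t *: y) = t * edot x y.
Proof. by rewrite mulr_sumr; apply: eq_bigr => i _; rewrite mxE mulrCA. Qed.

Lemma edotNr x y : edot x (- y) = - edot x y.
Proof. by rewrite -scaleN1r edotZr mulN1r. Qed.

Lemma edotDl x y z : edot (x + y) z = edot x z + edot y z.
Proof. by rewrite edotC edotDr !(edotC z). Qed.

Lemma edotZl t x y : edot (t *: x) y = t * edot x y.
Proof. by rewrite edotC edotZr edotC. Qed.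

Lemma edotNl x y : edot (- x) y = - edot x y.
Proof. by rewrite edotC edotNr edotC. Qed.

Lemma edotxx_ge0 x : 0 <= edot x x.
Proof. by apply: sumr_ge0 => i _; rewrite -expr2 sqr_ge0. Qed.

Lemma sqr_enorm x : enorm x ^+ 2 = edot x x.
Proof. by rewrite sqr_sqrtr// edotxx_ge0. Qed.

Lemma sqr_coord_le_edot x i : x 0 i ^+ 2 <= edot x x.
Proof.
rewrite /edot (bigD1 i)//= expr2 lerDl.
by apply: sumr_ge0 => j _; rewrite -expr2 sqr_ge0.
Qed.

Lemma edotxx_le0 x : edot x x <= 0 -> x = 0.
Proof.
move=> x0; apply/rowP => i; rewrite mxE; apply/eqP; rewrite -sqrf_eq0.
by rewrite eq_le sqr_ge0 andbT; apply: le_trans x0; exact: sqr_coord_le_edot.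
Qed.

Lemma enorm_gt0 x : x != 0 -> 0 < enorm x.
Proof.
apply: contraNT; rewrite lt_neqAle sqrtr_ge0 andbT negbK eq_sym sqrtr_eq0.
by move=> /edotxx_le0/eqP.
Qed.

Lemma enormZ t x : enorm (t *: x) = `|t| * enorm x.
Proof.
by rewrite /enorm edotZl edotZr mulrA -expr2 sqrtrM ?sqr_ge0// sqrtr_sqr.
Qed.

Definition edotE := (edotDl, edotDr, edotNl, edotNr, edotZl, edotZr).

(** The square of [a x + b y], expanded: the source of every quadratic
    inequality below, each time with its own [a] and [b]. *)
Lemma edot_combo_ge0 (a b : R) x y :
  0 <= a ^+ 2 * edot x x + 2 * a * b * edot x y + b ^+ 2 * edot y y.
Proof.
have := edotxx_ge0 (a *: x + b *: y); rewrite !edotE (edotC y x).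
by congr (_ <= _); ring.
Qed.

End EuclideanDot.

(** * Convexity up to a quadratic term *)

Section QuadraticConvexity.
Context {R : realType} {n : nat}.
Implicit Types (G F : 'rV[R]_n -> R) (x y z d v w : 'rV[R]_n) (s t : R).

(** Convexity of [G - (s/2)|.|^2], written without subtracting the quadratic;
    [s] may be negative. *)
Definition qconvex s G := forall x y t, 0 < t -> t < 1 ->
  G (t *: x + (1 - t) *: y) + s / 2 * (t * (1 - t)) * edot (x - y) (x - y)
    <= t * G x + (1 - t) * G y.

(** [v - s x] is a convex subgradient of [G - (s/2)|.|^2] at [x]. *)
Definition qsubgrad s G x v := forall z,
  G x + edot v (z - x) + s / 2 * edot (z - x) (z - x) <= G z.

(** Convexity with [x] as the interior point, cleared of denominators; the
    endpoints lie at distances [a] and [b] from [x] along [d]. *)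
Lemma qconvex_chord s G x d a b : qconvex s G -> 0 < a -> 0 < b ->
  (a + b) * G x + s / 2 * (a * b * (a + b)) * edot d d
    <= b * G (x - a *: d) + a * G (x + b *: d).
Proof.
move=> Gs a0 b0; have ab0 : 0 < a + b by rewrite addr_gt0.
have abN0 : a + b != 0 by rewrite gt_eqF.
have t0 : 0 < b / (a + b) by rewrite divr_gt0.
have t1 : b / (a + b) < 1 by rewrite ltr_pdivrMr// mul1r ltrDr.
have := Gs (x - a *: d) (x + b *: d) _ t0 t1.
have -> : (b / (a + b)) *: (x - a *: d) + (1 - b / (a + b)) *: (x + b *: d) = x.
  by apply/rowP => i; rewrite !mxE; field.
have -> : x - a *: d - (x + b *: d) = - (a + b) *: d.
  by apply/rowP => i; rewrite !mxE; ring.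
rewrite edotZl edotZr -(ler_pM2l ab0).
by congr (_ <= _); field.
Qed.

(** A convex function bounded above to first order near [x] by an affine one has
    the slope as a subgradient: if [G] fell short of the affine function at
    [x + d], convexity through [x] would push [G (x - t d)] above the bound. *)
Lemma qconvex_subgrad s G x w : qconvex s G ->
  (forall d e, 0 < e -> exists t,
    [/\ 0 < t, t < e & G (x - t *: d) <= G x - t * edot w d + t * e]) ->
  qsubgrad s G x w.
Proof.
move=> Gs wG z; suff H d : G x + edot w d + s / 2 * edot d d <= G (x + 1 *: d).
  by have := H (z - x); rewrite scale1r subrKC.
apply/ler_addgt0Pr => e e0.
have k0 : 0 < 1 + `|s / 2| * edot d d.
  by rewrite ltr_wpDr// mulr_ge0// edotxx_ge0.
have [t [t0 te Gt]] := wG d _ (divr_gt0 e0 k0).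
have := qconvex_chord _ _ x d t 1 Gs t0 ltr01.
set e' := e / _ in te Gt *; have -> : e = e' + `|s / 2| * edot d d * e'.
  by rewrite -[e in LHS](divfK (lt0r_neq0 k0)) -/e'; ring.
set D := edot d d in k0 *; have D0 : 0 <= D by exact: edotxx_ge0.
set g := G (x + 1 *: _); set T := edot w d in Gt *; set S := s / 2.
move=> chord; rewrite -(ler_pM2l t0).
(* [chord] carries an extra [S D t^2], which [t < e'] makes negligible. *)
have : - S * D * t ^+ 2 <= t * (`|S| * D * e').
  rewrite (_ : - S * D * t ^+ 2 = t * (- S * D * t)); last by ring.
  rewrite ler_pM2l//.
  apply: (@le_trans _ _ (`|S| * D * t)).
    by rewrite ler_wpM2r ?(ltW t0)// ler_wpM2r// -normrN ler_norm.
  by rewrite ler_wpM2l ?(ltW te)// mulr_ge0.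
lra.
Qed.

Lemma qconvex_subgrad_quad s K G x w : qconvex s G ->
  (forall d, G (x + d) <= G x + edot w d + K * edot d d) -> qsubgrad s G x w.
Proof.
move=> Gs wG; apply: qconvex_subgrad => // d e e0.
pose t := e / 2 / (1 + `|K| * edot d d).
have k1 : 1 <= 1 + `|K| * edot d d.
  by rewrite lerDl mulr_ge0// edotxx_ge0.
have k0 := lt_le_trans ltr01 k1.
have t0 : 0 < t by rewrite !divr_gt0.
have tk : t * (1 + `|K| * edot d d) = e / 2 by rewrite divfK// gt_eqF.
have tKe : t * (`|K| * edot d d) <= e by nra.
exists t; split=> //; first by nra.
apply: le_trans (wG _) _; rewrite !edotE !mulrN opprK.
rewrite lerD2l [K * _]mulrCA ler_wpM2l ?(ltW t0)//.
apply: le_trans tKe; rewrite mulrCA ler_wpM2l ?(ltW t0)//.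
by rewrite ler_wpM2r ?edotxx_ge0// ler_norm.
Qed.

(** Along a line, left difference quotients never exceed right ones, once both
    are corrected by the quadratic term; any number between them is a slope, and
    the supremum of the left ones is such a number. *)
Lemma qconvex_dir_subgrad s G x d : qconvex s G ->
  exists p, forall t, G x + t * p + s / 2 * t ^+ 2 * edot d d <= G (x + t *: d).
Proof.
move=> Gs; set S := s / 2; set D := edot d d.
pose L a := (G x - G (x - a *: d)) / a + S * a * D.
pose U b := (G (x + b *: d) - G x) / b - S * b * D.
have LU a b : 0 < a -> 0 < b -> L a <= U b.
  move=> a0 b0; have := qconvex_chord _ _ x d _ _ Gs a0 b0.
  rewrite -/S -/D => h.
  rewrite -(ler_pM2l (mulr_gt0 a0 b0)) -subr_ge0.
  have -> : a * b * U b - a * b * L a = b * G (x - a *: d) + a * G (x + b *: d)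
      - ((a + b) * G x + S * (a * b * (a + b)) * D).
    by rewrite /U /L; field; rewrite !gt_eqF.
  by rewrite subr_ge0.
pose E := [set L a | a in [set a | 0 < a]].
have E0 : E !=set0 by exists (L 1), 1 => //=; rewrite ltr01.
have ubE b : 0 < b -> ubound E (U b) by move=> b0 _ [a a0 <-]; exact: LU.
exists (sup E) => t; case: (ltrgtP t 0) => [t0|t0|->].
- have : L (- t) <= sup E.
    apply: ub_le_sup; first by exists (U 1); apply: ubE.
    by exists (- t) => //=; rewrite oppr_gt0.
  rewrite /L scaleNr opprK -(ler_nM2l t0).
  have -> : t * ((G x - G (x + t *: d)) / - t + S * - t * D)
          = G (x + t *: d) - G x - S * t ^+ 2 * D.
    by field; rewrite lt_eqF.
  lra.
- have : sup E <= U t by apply: ge_sup => //; exact: ubE.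
  rewrite /U -(ler_pM2l t0).
  have -> : t * ((G (x + t *: d) - G x) / t - S * t * D)
          = G (x + t *: d) - G x - S * t ^+ 2 * D.
    by field; rewrite gt_eqF.
  lra.
- by rewrite scale0r addr0 expr0n/=; lra.
Qed.

(** Upper bounds along the axes combine into one in all directions: midpoint
    convexity splits off one coordinate at a time, the induction being on the
    number [k] of coordinates that a displacement may use.  The constant roughly
    doubles at each step, but only its existence matters. *)
Lemma qconvex_coord_ub s K F x (p : 'rV[R]_n) : qconvex s F ->
  (forall i t, F (x + t *: delta_mx 0 i) <= F x + t * p 0 i + K * t ^+ 2) ->
  exists C, forall d, F (x + d) <= F x + edot p d + C * edot d d.
Proof.
move=> Fs Fp.
suff H k : (k <= n)%N -> exists2 C, 0 <= C & forall d,
    (forall i : 'I_n, (k <= i)%N -> d 0 i = 0) ->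
    F (x + d) <= F x + edot p d + C * edot d d.
  have [C _ CF] := H n (leqnn n); exists C => d; apply: CF => i.
  by rewrite leqNgt ltn_ord.
elim: k => [_|k IH kn].
  exists 0 => // d d0; have -> : d = 0 by apply/rowP => i; rewrite d0// mxE.
  by rewrite /edot !big1 ?addr0 ?mulr0 ?addr0// => i _; rewrite mxE mulr0.
have [C C0 CF] := IH (ltnW kn); pose i0 := Ordinal kn.
exists (2 * C + 2 * `|K| + `|s|); first by rewrite !addr_ge0// mulr_ge0.
move=> d dk; pose b : 'rV[R]_n := d 0 i0 *: delta_mx 0 i0; pose a := d - b.
have bE i : b 0 i = if i == i0 then d 0 i0 else 0.
  by rewrite !mxE eqxx/=; case: ifP; rewrite ?mulr1 ?mulr0.
have aE i : a 0 i = if i == i0 then 0 else d 0 i.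
  rewrite /a mxE [(- b) 0 i]mxE bE; case: ifP => [/eqP->|_].
    by rewrite subrr.
  by rewrite subr0.
have ak (i : 'I_n) : (k <= i)%N -> a 0 i = 0.
  rewrite aE; case: (eqVneq i i0) => // ii0 ki; apply: dk; rewrite ltn_neqAle ki.
  by rewrite andbT eq_sym.
have dE : d = a + b by rewrite subrK.
have ab : edot a b = 0.
  by apply: big1 => i _; rewrite aE bE; case: ifP; rewrite ?mul0r ?mulr0.
have pb : edot p b = d 0 i0 * p 0 i0.
  rewrite edotZr; congr (_ * _).
  rewrite /edot (bigD1 i0)//= big1 ?addr0 => [|i ii0].
    by rewrite mxE !eqxx mulr1.
  by rewrite mxE (negPf ii0) andbF mulr0.
have bb : edot b b = d 0 i0 ^+ 2.
  rewrite /edot (bigD1 i0)//= big1 ?addr0 => [|i ii0].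
    by rewrite bE eqxx expr2.
  by rewrite bE (negPf ii0) mulr0.
have h0 : 0 < 2^-1 :> R by rewrite invr_gt0.
have h1 : 2^-1 < 1 :> R by rewrite invf_lt1// ltr1n.
have := Fs (x + 2 *: a) (x + 2 *: b) _ h0 h1.
have -> : 2^-1 *: (x + 2 *: a) + (1 - 2^-1) *: (x + 2 *: b) = x + d.
  have mid (u w : 'rV[R]_n) :
      2^-1 *: (x + 2 *: u) + (1 - 2^-1) *: (x + 2 *: w) = x + (u + w).
    by apply/rowP => i; rewrite !mxE; field.
  by rewrite mid -dE.
have -> : x + 2 *: a - (x + 2 *: b) = 2 *: (a - b).
  have sub2 (u w : 'rV[R]_n) : x + 2 *: u - (x + 2 *: w) = 2 *: (u - w).
    by apply/rowP => i; rewrite !mxE; ring.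
  exact: sub2.
have Fa : F (x + 2 *: a) <= F x + edot p (2 *: a) + C * edot (2 *: a) (2 *: a).
  by apply: CF => i ki; rewrite mxE ak ?mulr0.
have Fb : F (x + 2 *: b) <= F x + 2 * edot p b + 4 * `|K| * edot b b.
  rewrite scalerA; apply: le_trans (Fp _ _) _.
  rewrite pb bb -!mulrA lerD2l exprMn mulrCA.
  rewrite (_ : 2 ^+ 2 = 4); last by ring.
  by rewrite ler_pM2l// ler_wpM2r ?sqr_ge0// ler_norm.
(* Opaque [a] and [b] keep the rewriting from seeing [a] as a difference. *)
clearbody a b; rewrite dE !edotE (edotC b a) ab in Fa *.
have A0 := edotxx_ge0 a; have B0 := edotxx_ge0 b.
set A := edot a a in A0 Fa *; set B := edot b b in B0 Fb *.
have K0 := normr_ge0 K.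
have sAB : - `|s| * (A + B) <= s * (A + B).
  by apply: ler_wpM2r; [exact: addr_ge0|rewrite lerNl -normrN ler_norm].
have KA : 0 <= `|K| * A by rewrite mulr_ge0.
have CB : 0 <= C * B by rewrite mulr_ge0.
have sA : 0 <= `|s| * (A + B) by rewrite mulr_ge0// addr_ge0.
lra.
Qed.

(** Curvature bounds on both sides give a common slope: subgradients of [- F]
    along the axes bound [F] above, whence a lower bound for [F] with slope [v];
    read as an upper bound for [- F], it gives the other half. *)
Lemma qconvex_two_sided s l F x : qconvex s F -> qconvex (- l) (\- F) ->
  exists2 v, qsubgrad s F x v & qsubgrad (- l) (\- F) x (- v).
Proof.
move=> Fs Fl.
have [q qP] := choice (fun i => qconvex_dir_subgrad _ _ x (delta_mx 0 i) Fl).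
pose v : 'rV[R]_n := \row_i - q i.
have ee i : edot (delta_mx 0 i : 'rV[R]_n) (delta_mx 0 i) = 1.
  rewrite /edot (bigD1 i)//= big1 ?addr0 => [|j ji].
    by rewrite mxE !eqxx mulr1.
  by rewrite mxE (negPf ji) andbF mulr0.
have [|C CF] := @qconvex_coord_ub s (l / 2) F x v Fs.
  by move=> i t; have := qP i t; rewrite /= ee mxE; lra.
have sF := qconvex_subgrad_quad _ _ _ _ _ Fs CF.
exists v => //; apply: (@qconvex_subgrad_quad _ (- s / 2)) => // d.
by have := sF (x + d); rewrite [x + d - x]addrC addKr edotNl/=; lra.
Qed.

(** Adding the two inequalities at any two distinct points leaves
    [(s - l)|x - y|^2 <= 0]; distinct points need a positive dimension. *)
Lemma qconvex_bounds s l F : (0 < n)%N -> qconvex s F -> qconvex (- l) (\- F) ->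
  s <= l.
Proof.
move=> n0 Fs Fl; pose e : 'rV[R]_n := const_mx 1.
have h0 : 0 < 2^-1 :> R by rewrite invr_gt0.
have h1 : 2^-1 < 1 :> R by rewrite invf_lt1// ltr1n.
have := Fs e 0 _ h0 h1; have := Fl e 0 _ h0 h1; rewrite subr0.
have : 1 <= edot e e.
  by have := sqr_coord_le_edot e (Ordinal n0); rewrite mxE expr1n.
move: (edot e e) => E E1 /= A B.
have : s * E <= l * E by lra.
by rewrite ler_pM2r// (lt_le_trans _ E1).
Qed.

End QuadraticConvexity.

(** * Differentiability from quadratic bounds *)

Section GradientOfQuadraticBounds.
Context {R : realType} {n : nat}.
Implicit Types (F : 'rV[R]_n -> R) (x d v : 'rV[R]_n).

Lemma norm_le_enorm d : `|d| <= enorm d.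
Proof.
rewrite [leLHS]/Num.Def.normr/= mx_normrE; apply: bigmax_le => [|[i j] _ /=].
  exact: sqrtr_ge0.
rewrite ord1 -sqrtr_sqr ler_sqrt ?edotxx_ge0//; exact: sqr_coord_le_edot.
Qed.

Lemma coord_le_norm d i : `|d 0 i| <= `|d|.
Proof.
by rewrite [leRHS]/Num.Def.normr/= mx_normrE; apply/bigmax_geP; right;
  exists (0, i).
Qed.

Lemma edotxx_le_norm d : edot d d <= n%:R * `|d| ^+ 2.
Proof.
apply: (@le_trans _ _ (\sum_(i < n) `|d| ^+ 2)).
  apply: ler_sum => i _; rewrite -expr2 -real_normK ?num_real//.
  by rewrite lerXn2r ?nnegrE// coord_le_norm.
by rewrite sumr_const card_ord mulr_natl.
Qed.

Lemma cvg_edot {T : Type} (H : set_system T) {FH : Filter H}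
    (a b : T -> 'rV[R]_n) x y :
  a t @[t --> H] --> x -> b t @[t --> H] --> y ->
  edot (a t) (b t) @[t --> H] --> edot x y.
Proof.
move=> ax bY.
have : (\sum_(i < n) (fun t => a t 0 i * b t 0 i)) @ H --> edot x y.
  rewrite /edot; elim/big_ind2 : _ => [|u p w q up wq|i _].
  - exact: cvg_cst.
  - exact: cvgD.
  - apply: cvgM.
    + apply: (@cvg_comp _ _ _ a (fun M : 'rV[R]_n => M 0 i) _ _ _ ax).
      exact: coord_continuous.
    + apply: (@cvg_comp _ _ _ b (fun M : 'rV[R]_n => M 0 i) _ _ _ bY).
      exact: coord_continuous.
by rewrite fct_sumE.
Qed.

(** A quadratic error is little-o of the norm; the Euclidean norm is at most the
    square root of the dimension times the sup norm. *)
Lemma quad_gradient F x v C : 0 <= C ->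
  (forall d, `|F (x + d) - F x - edot v d| <= C * edot d d) ->
  differentiable F x /\ gradient F x = v.
Proof.
move=> C0 FC.
have lin : linear (edot v) by move=> k y z; rewrite edotDr edotZr.
pose L : {linear 'rV[R]_n -> R} :=
  HB.pack (edot v) (GRing.isLinear.Build _ _ _ _ _ lin).
have Lc : continuous L by 
  by move=> y; apply: (@cvg_edot _ (nbhs y) _ (fun=> v) id v y);
    first exact: cvg_cst.
have FL : F \o shift x = cst (F x) + L +o_ (0 : 'rV[R]_n) id.
  apply/(@eqaddoP R _ R 'rV[R]_n) => e e0.
  have k0 : 0 < 1 + C * n%:R by rewrite ltr_pwDl// mulr_ge0.
  apply/nbhs_ballP; exists (e / (1 + C * n%:R)) => /=; first by rewrite divr_gt0.
  move=> d; rewrite -ball_normE/= sub0r normrN ltr_pdivlMr// => de.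
  have -> : (F \o shift x - (cst (F x) + L)) d = F (x + d) - F x - edot v d.
    by rewrite addrAC -addrA -opprD [x + d]addrC; congr (_ - _); rewrite addrC.
  apply: le_trans (FC d) _; apply: (@le_trans _ _ (C * (n%:R * `|d| ^+ 2))).
    by rewrite ler_wpM2l// edotxx_le_norm.
  have := normr_ge0 d; move: `|d| de => D de D0; nra.
have dF := diff_unique Lc FL; split.
  by apply/diff_locallyP; rewrite dF.
apply/rowP => i; rewrite mxE dF /= /edot (bigD1 i)//= big1 ?addr0 => [|j ji].
  by rewrite mxE !eqxx mulr1.
by rewrite mxE (negPf ji) andbF mulr0.
Qed.

Lemma edot_lipschitz_continuous (g : 'rV[R]_n -> 'rV[R]_n) M : 0 <= M ->
  (forall x y, edot (g x - g y) (g x - g y) <= M * edot (x - y) (x - y)) ->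
  continuous g.
Proof.
move=> M0 gM x; apply/(cvgrPdist_lt (FF := nbhs_filter x)) => e e0.
have k0 : 0 < 1 + M * n%:R by rewrite ltr_pwDl// mulr_ge0.
apply/nbhs_ballP; exists (e / (1 + M * n%:R)) => /=; first by rewrite divr_gt0.
move=> y; rewrite -ball_normE/= ltr_pdivlMr// => de.
apply: le_lt_trans (norm_le_enorm _) _.
rewrite -(@ltr_pXn2r _ 2) ?nnegrE ?sqrtr_ge0 ?(ltW e0)// sqr_enorm.
apply: le_lt_trans (gM _ _) _.
apply: (@le_lt_trans _ _ (M * (n%:R * `|x - y| ^+ 2))).
  by rewrite ler_wpM2l// edotxx_le_norm.
have K0 : 0 <= M * n%:R by rewrite mulr_ge0.
have := normr_ge0 (x - y); rewrite mulrA; move: `|x - y| (M * n%:R) de K0 {k0}.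
move=> D K de K0 D0.
have : (D * (1 + K)) ^+ 2 < e ^+ 2.
  by rewrite ltrXn2r// ?mulr_ge0 ?addr_ge0.
rewrite exprMn; have := sqr_ge0 D; nra.
Qed.

End GradientOfQuadraticBounds.

(** * Monotonicity and cocoercivity of subgradients *)

Section SubgradientInequalities.
Context {R : realType} {n : nat}.
Implicit Types (F G : 'rV[R]_n -> R) (x d v : 'rV[R]_n) (s l : R).

Lemma qsubgrad_monotone s G x x' v v' :
  qsubgrad s G x v -> qsubgrad s G x' v' ->
  s * edot (x - x') (x - x') <= edot (x - x') (v - v').
Proof.
move=> /(_ x') h /(_ x) h'.
rewrite -opprB (edotC _ (v - v')) !edotE in h h' *.
lra.
Qed.

(** The Baillon-Haddad argument for [F - (s/2)|.|^2].  At [x' + t p] the lower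
    bound issued from [x] cannot exceed the upper bound issued from [x']; adding
    the mirrored comparison leaves [(2 t - (l - s) t^2)|p|^2 <= <x - x', p>] for
    all [t], and [t = 1 / (l - s)] is optimal.  When [l = s], large [t] force
    [p = 0]. *)
Lemma qsubgrad_cocoercive s l F x x' v v' p : s <= l ->
  p = v - v' - s *: (x - x') ->
  qsubgrad s F x v -> qsubgrad (- l) (\- F) x (- v) ->
  qsubgrad s F x' v' -> qsubgrad (- l) (\- F) x' (- v') ->
  edot p p <= (l - s) * edot (x - x') p.
Proof.
move=> sl pE h1 h2 h1' h2'.
have gap (y y' w w' q : 'rV[R]_n) t : q = w - w' - s *: (y - y') ->
    qsubgrad s F y w -> qsubgrad (- l) (\- F) y' (- w') ->
    F y - F y' - edot w (y - y') + s / 2 * edot (y - y') (y - y')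
      + (t - (l - s) / 2 * t ^+ 2) * edot q q <= 0.
  move=> qE /(_ (y' + t *: q)) h /(_ (y' + t *: q)); move: h.
  have -> : y' + t *: q - y' = t *: q by rewrite addrC addKr.
  have -> : y' + t *: q - y = t *: q - (y - y').
    by apply/rowP => i; rewrite !mxE; ring.
  have qq : edot q q = edot w q - edot w' q - s * edot (y - y') q.
    by rewrite {1}qE !edotE.
  move: (y - y') qq => u qq.
  rewrite !edotE (edotC q u)/=.
  move: qq; move: (edot q q) (edot w q) (edot w' q) (edot u q) => P A B D qq.
  have : t * P = t * A - t * B - t * s * D by rewrite qq; ring.
  lra.
have qE : - p = v' - v - s *: (x' - x).
  by rewrite pE !opprB -[x' - x]opprB scalerN opprK addrC.
have up : edot (x - x') p
        = edot v (x - x') - edot v' (x - x') - s * edot (x - x') (x - x').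
  by rewrite pE edotC edotDl edotNl edotZl edotDl edotNl.
have key t : (2 * t - (l - s) * t ^+ 2) * edot p p <= edot (x - x') p.
  have := gap _ _ _ _ _ t pE h1 h2'.
  have := gap _ _ _ _ _ t qE h1' h2.
  rewrite up -[x' - x]opprB !edotNr !edotNl !opprK.
  lra.
have p0 := edotxx_ge0 p.
move: sl; rewrite le_eqVlt => /predU1P[sl|sl]; last first.
  have ls : 0 < l - s by rewrite subr_gt0.
  rewrite -ler_pdivrMl//; apply: le_trans (key (l - s)^-1).
  by rewrite le_eqVlt; apply/orP; left; apply/eqP; field; rewrite gt_eqF.
move: key; rewrite sl subrr mul0r.
move: (edot p p) (edot (x - x') p) p0 => P T P0 key.
rewrite leNgt; apply/negP => {}P0.
have := key ((`|T| + 1) / P).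
rewrite mul0r subr0 -mulrA divfK ?gt_eqF// => h.
have := ler_norm T; have := normr_ge0 T; lra.
Qed.
End SubgradientInequalities.

(** * Curvature classes and subdifferentials *)

Section Curvature.
Context {R : realType} {n : nat}.
Implicit Types (f g : 'rV[R]_n -> \bar R) (x y z d v w : 'rV[R]_n).
Implicit Types (s l e t : R).

Lemma edot_segment x y t :
  edot (t *: x + (1 - t) *: y) (t *: x + (1 - t) *: y)
  = t * edot x x + (1 - t) * edot y y - t * (1 - t) * edot (x - y) (x - y).
Proof. by rewrite !edotE (edotC y x); ring. Qed.

Lemma econvex_le g x y t a b : econvex g -> g x = a%:E -> g y = b%:E ->
  0 < t -> t < 1 -> (g (t *: x + (1 - t) *: y)%R <= (t * a + (1 - t) * b)%:E)%E.
Proof. by move=> gc gx gy t0 t1; have := gc x y t t0 t1; rewrite gx gy. Qed.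

(** The domain of [f] is convex, so that the inequality may be stated between
    real numbers even though [f] may be infinite elsewhere. *)
Lemma lower_curvature_segment s f x y t :
  (forall z, -oo < f z)%E -> lower_curvature s f ->
  f x \is a fin_num -> f y \is a fin_num -> 0 < t -> t < 1 ->
  f (t *: x + (1 - t) *: y) \is a fin_num /\
  fine (f (t *: x + (1 - t) *: y))
    + s / 2 * (t * (1 - t)) * edot (x - y) (x - y)
    <= t * fine (f x) + (1 - t) * fine (f y).
Proof.
move=> fNy fs /fineK fx /fineK fy t0 t1.
have gE u : f u = (fine (f u))%:E ->
    (f u - (s / 2 * enorm u ^+ 2)%:E)%E = (fine (f u) - s / 2 * edot u u)%:E.
  by move=> ->; rewrite sqr_enorm.
have := econvex_le _ _ _ _ _ _ fs (gE x (esym fx)) (gE y (esym fy)) t0 t1.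
rewrite /= sqr_enorm edot_segment.
case: (f _) (fNy (t *: x + (1 - t) *: y)) => [r|//|//] _.
rewrite -EFinB lee_fin => h; split=> //=; lra.
Qed.

Lemma lower_curvature_qconvex s f : (forall z, f z \is a fin_num) ->
  lower_curvature s f -> qconvex s (fine \o f).
Proof.
move=> ffin fs x y t t0 t1.
have fNy z : (-oo < f z)%E by rewrite ltNye_eq ffin.
by have [] := lower_curvature_segment _ _ _ _ _ fNy fs (ffin x) (ffin y) t0 t1.
Qed.

Lemma upper_curvature_qconvex l f : upper_curvature l f ->
  qconvex (- l) (\- (fine \o f)).
Proof.
move=> [ffin fl] x y t t0 t1.
have gE u : ((l / 2 * enorm u ^+ 2)%:E - f u)%E
          = (l / 2 * edot u u - fine (f u))%:E.
  by rewrite -{1}(fineK (ffin u)) sqr_enorm.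
have := econvex_le _ _ _ _ _ _ fl (gE x) (gE y) t0 t1.
rewrite /= gE lee_fin edot_segment; lra.
Qed.

(** The limit inferior of the difference quotients is taken over punctured
    neighbourhoods; multiplied out, the bound also holds at [x] itself. *)
Lemma regular_subdiff_near f x v e : (forall z, -oo < f z)%E ->
  regular_subdiff f x v -> 0 < e ->
  \forall z \near x,
    ((fine (f x) + edot v (z - x) - e * enorm (z - x))%R%:E <= f z)%E.
Proof.
move=> fNy [fx]; rewrite limf_einfE => inf0 e0.
have /ereal_sup_gt[_ [A xA <-] eA] :
    ((- e)%:E < ereal_sup [set ereal_inf [set ((f z - f x
      - (edot v (z - x)%R)%:E) / (enorm (z - x)%R)%:E)%E | z in V] | V in x^'])%E.
  by apply: lt_le_trans inf0; rewrite lte_fin oppr_lt0.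
have {}xA : \forall z \near x, z != x -> A z by exact: xA.
apply: filterS xA => z zA; have [->|zx] := eqVneq z x.
  by rewrite subrr /enorm /edot !big1 ?sqrtr0 ?mulr0 ?subr0 ?addr0 ?fineK//
    => i _; rewrite mxE mulr0.
have := lt_le_trans eA (ereal_inf_lbound (ex_intro2 _ _ z (zA zx) erefl)).
have r0 : 0 < enorm (z - x) by rewrite enorm_gt0// subr_eq0.
rewrite -(fineK fx) inver gt_eqF//=.
case: (f z) (fNy z) => [b||//] _; last by rewrite leey.
rewrite -!EFinB -EFinM lte_fin lee_fin ltr_pdivlMr//; lra.
Qed.

Lemma near_direction (P : set 'rV[R]_n) x d e : (\forall z \near x, P z) ->
  0 < e -> exists t, [/\ 0 < t, t < e & P (x + t *: d)].
Proof.
move=> /nbhs_ballP[r/= r0 rP] e0.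
have k0 : 0 < 1 + `|d| by rewrite ltr_pwDl.
have r2 : 0 < r / 2 / (1 + `|d|) by rewrite !divr_gt0.
have m0 : 0 < Num.min (e / 2) (r / 2 / (1 + `|d|)) by rewrite lt_min r2 divr_gt0.
exists (Num.min (e / 2) (r / 2 / (1 + `|d|))); split=> //.
  by rewrite gt_min; apply/orP; left; lra.
apply: rP; rewrite -ball_normE/= opprD addrA subrr add0r normrN normrZ gtr0_norm//.
apply: (@le_lt_trans _ _ (r / 2 / (1 + `|d|) * `|d|)).
  by rewrite ler_wpM2r// ge_min lexx orbT.
apply: (@le_lt_trans _ _ (r / 2 / (1 + `|d|) * (1 + `|d|))).
  by rewrite ler_pM2l// lerDr.
by rewrite divfK ?gt_eqF//; lra.
Qed.

(** Convexity along the segment from [x] to [z] carries the first-order bound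
    near [x] over to [z]; [K] below collects the errors so that they add up to
    [e]. *)
Lemma regular_subdiff_lower s f x v z : (forall z, -oo < f z)%E ->
  lower_curvature s f -> regular_subdiff f x v -> f z \is a fin_num ->
  fine (f x) + edot v (z - x) + s / 2 * edot (z - x) (z - x) <= fine (f z).
Proof.
move=> fNy fs xv fz; have fx := xv.1.
set d := z - x; apply/ler_addgt0Pr => e e0.
pose K := 1 + enorm d + `|s / 2| * edot d d.
have r0 : 0 <= enorm d := sqrtr_ge0 _.
have sD0 : 0 <= `|s / 2| * edot d d by rewrite mulr_ge0 ?edotxx_ge0.
have K0 : 0 < K by rewrite /K -addrA ltr_pwDl// addr_ge0.
have eK : 0 < e / K by rewrite divr_gt0.
have m0 : 0 < Num.min 1 (e / K) by rewrite lt_min ltr01.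
have near_v := regular_subdiff_near _ _ _ _ fNy xv eK.
have [t [t0 tm]] := near_direction _ _ d _ near_v m0.
have t1 : t < 1 by apply: lt_le_trans tm _; rewrite ge_min lexx.
have teK : t < e / K by apply: lt_le_trans tm _; rewrite ge_min lexx orbT.
have [fm] := lower_curvature_segment _ _ _ _ _ fNy fs fz fx t0 t1.
have mE : t *: z + (1 - t) *: x = x + t *: d.
  by apply/rowP => i; rewrite !mxE; ring.
rewrite mE in fm *; rewrite -{2}(fineK fm) lee_fin [x + _ - x]addrC addKr.
rewrite enormZ gtr0_norm// edotZr -/d.
move: (fine (f (x + t *: d))) => m mle lem.
have sS : - (`|s / 2| * edot d d * (e / K)) <= - (s / 2 * edot d d * t).
  rewrite lerN2; apply: (@le_trans _ _ (`|s / 2| * edot d d * t)).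
    by rewrite ler_wpM2r ?(ltW t0)// ler_wpM2r ?edotxx_ge0// ler_norm.
  by rewrite ler_wpM2l// ltW.
have eE : e = e / K + e / K * enorm d + `|s / 2| * edot d d * (e / K).
  by rewrite -[LHS](divfK (lt0r_neq0 K0)) {2}/K; ring.
move: (e / K) eK sS eE {teK tm m0} lem mle => e' e'0 sS -> lem mle.
rewrite -(ler_pM2l t0).
have := ler_wpM2l (ltW t0) sS; have : 0 < t * e' by rewrite mulr_gt0.
lra.
Qed.

(** A lower first-order bound on [f] is an upper one on [- f], which is convex up
    to a quadratic. *)
Lemma regular_subdiff_upper l f x v : upper_curvature l f ->
  regular_subdiff f x v -> qsubgrad (- l) (\- (fine \o f)) x (- v).
Proof.
move=> fl xv; have ffin := fl.1.
have fNy z : (-oo < f z)%E by rewrite ltNye_eq ffin.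
apply: qconvex_subgrad; first exact: upper_curvature_qconvex.
move=> d e e0; have K0 : 0 < 1 + enorm d by rewrite ltr_pwDl// sqrtr_ge0.
have eK : 0 < e / (1 + enorm d) by rewrite divr_gt0.
have near_v := regular_subdiff_near _ _ _ _ fNy xv eK.
have [t [t0 te]] := near_direction _ _ (- d) _ near_v e0.
rewrite -(fineK (ffin (x + t *: - d))) lee_fin [x + _ - x]addrC addKr.
rewrite enormZ gtr0_norm// edotZr edotNr.
have -> : enorm (- d) = enorm d by rewrite -scaleN1r enormZ normrN1 mul1r.
rewrite scalerN => h; exists t; split=> //=.
have : e / (1 + enorm d) * enorm d <= e.
  by rewrite mulrAC ler_pdivrMr// ler_pM2l// lerDr.
move=> /(ler_wpM2l (ltW t0)); rewrite edotNl; lra.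
Qed.

(** At a fixed [z], the quadratic model issued from a limiting subgradient is the
    limit of models issued from regular ones, because the approximating sequence
    is [f]-attentive; quadratic bounds in either direction thus pass to the
    limit. *)
Lemma limiting_subdiff_cvg s f x y z : limiting_subdiff f x y ->
  exists x_ v_ : nat -> 'rV[R]_n, (forall k, regular_subdiff f (x_ k) (v_ k)) /\
    (fine (f (x_ k)) + edot (v_ k) (z - x_ k)
      + s / 2 * edot (z - x_ k) (z - x_ k)) @[k --> \oo]
    --> fine (f x) + edot y (z - x) + s / 2 * edot (z - x) (z - x).
Proof.
move=> [fx [x_ [v_ [rv xx fxx vv]]]]; exists x_, v_; split=> //.
have zx : (z - x_ k) @[k --> \oo] --> z - x by apply: cvgB => //; exact: cvg_cst.
apply: cvgD; first apply: cvgD.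
- by apply: fine_cvg; rewrite fineK.
- exact: cvg_edot.
- by apply: cvgM; [exact: cvg_cst|exact: cvg_edot].
Qed.

Lemma limiting_subdiff_lower s f x y z : (forall z, -oo < f z)%E ->
  lower_curvature s f -> limiting_subdiff f x y -> f z \is a fin_num ->
  fine (f x) + edot y (z - x) + s / 2 * edot (z - x) (z - x) <= fine (f z).
Proof.
move=> fNy fs /(limiting_subdiff_cvg s _ _ _ z)[x_ [v_ [rv cv]]] fz.
apply: (cvgr_to_le cv); apply: nearW => k.
exact: regular_subdiff_lower.
Qed.

Lemma limiting_subdiff_upper l f x y : upper_curvature l f ->
  limiting_subdiff f x y -> qsubgrad (- l) (\- (fine \o f)) x (- y).
Proof.
move=> fl xy z.
have [x_ [v_ [rv cv]]] := limiting_subdiff_cvg l _ _ _ z xy.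
have : fine (f z) <= fine (f x) + edot y (z - x) + l / 2 * edot (z - x) (z - x).
  apply: (cvgr_to_ge cv); apply: nearW => k.
  have := regular_subdiff_upper _ _ _ _ fl (rv k) z; rewrite /= edotNl; lra.
rewrite /= edotNl; lra.
Qed.

Lemma lower_upper_gradient s l f : lower_upper_curvature s l f ->
  forall x, [/\ differentiable (fine \o f) x,
    qsubgrad s (fine \o f) x (gradient (fine \o f) x) &
    qsubgrad (- l) (\- (fine \o f)) x (- gradient (fine \o f) x)].
Proof.
move=> [fs fl] x.
have [v vs vl] := qconvex_two_sided _ _ _ x
  (lower_curvature_qconvex _ _ fl.1 fs) (upper_curvature_qconvex _ _ fl).
have [|d|dF gF] := quad_gradient (fine \o f) x v (`|s / 2| + `|l / 2|).
- by rewrite addr_ge0.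
- have := vs (x + d); have := vl (x + d); rewrite [x + d - x]addrC addKr edotNl /=.
  have D0 := edotxx_ge0 d; rewrite ler_norml.
  have s1 : - `|s / 2| * edot d d <= s / 2 * edot d d.
    by rewrite ler_wpM2r// lerNl -normrN ler_norm.
  have l1 : l / 2 * edot d d <= `|l / 2| * edot d d.
    by rewrite ler_wpM2r// ler_norm.
  have s2 : 0 <= `|s / 2| * edot d d by rewrite mulr_ge0.
  have l2 : 0 <= `|l / 2| * edot d d by rewrite mulr_ge0.
  move=> h1 h2; apply/andP; split; lra.
by rewrite gF.
Qed.

(** The same formula covers [L = 0], where the inverse is [+oo] and the parallel
    sum is [c]. *)
Lemma parallel_sum_inv (c L : R) : 1 + c * L != 0 ->
  parallel_sum c (L%:E^-1)%E = c / (1 + c * L).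
Proof.
move=> h; rewrite inver; case: eqVneq => [L0|L0] /=.
  by rewrite L0 mulr0 addr0 divr1.
have -> : c + L^-1 = (1 + c * L) / L by field.
rewrite mulf_eq0 invr_eq0 (negPf h) (negPf L0)/=; field.
by rewrite h.
Qed.

End Curvature.

(** * Quadratic forms behind the semimonotonicity moduli *)

Section SemimonotoneAlgebra.
Context {R : realType} {n : nat}.
Implicit Types (u w p : 'rV[R]_n) (s l a c : R).

(** [|w|^2 >= 2 l <u, w> - l^2 |u|^2 >= l <u, w>], the second step because
    [l < 0] reverses the hypothesis. *)
Lemma strongly_dissipative_semimonotone l u w :
  l < 0 -> edot u w <= l * edot u u ->
  1 / l * edot w w <= edot u w.
Proof.
move=> l0 uw; rewrite mulrAC mul1r ler_ndivrMr//.
have := edot_combo_ge0 l (- 1) u w.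
have := ler_wnM2l (ltW l0) uw; lra.
Qed.

(** With [D] the negative number [1 + c (l - a)], both coefficients on the left
    are negative and four times their product is at least 1, because
    [- D <= 4 c a (c a - 1)].  The difference of the two sides is thus a positive
    semidefinite form in [(u, w)]. *)
Lemma indefinite_semimonotone l a c u w : 0 <= l -> l < a -> 1 / (a - l) < c ->
  a * (1 - c * a) * edot u u + c / (1 + c * (l - a)) * edot w w <= edot u w.
Proof.
move=> l0 la; have al : 0 < a - l by rewrite subr_gt0.
rewrite ltr_pdivrMr// => cal.
have a0 : 0 < a by apply: le_lt_trans la.
have c0 : 0 < c by rewrite -(pmulr_lgt0 _ al); exact: lt_trans cal.
set D := 1 + c * (l - a); have D0 : D < 0 by rewrite /D; lra.
rewrite -(ler_nM2l D0) mulrDr mulrA.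
rewrite [D * (c / D * _)](_ : _ = c * edot w w); last first.
  by field; rewrite lt_eqF.
rewrite -(ler_pM2l (_ : 0 < 4 * c)); last by rewrite mulr_gt0.
have ac : - D <= 4 * (c * a) * (c * a - 1).
  have cl : 0 <= c * l by rewrite mulr_ge0// ltW.
  rewrite /D in D0 *; nra.
have U0 := edotxx_ge0 u.
have := edot_combo_ge0 (- D) (2 * c) u w.
have DD : 0 <= - D * (4 * (c * a) * (c * a - 1) + D) * edot u u.
  by rewrite mulr_ge0// mulr_ge0//; lra.
lra.
Qed.

Lemma cocoercive_semimonotone_pos s l u w : 0 < l + s ->
  edot (w - s *: u) (w - s *: u) <= (l - s) * edot u (w - s *: u) ->
  s * l / (s + l) * edot u u + 1 / (l + s) * edot w w <= edot u w.
Proof.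
move=> ls h; rewrite (addrC s) -(ler_pM2l ls).
have -> : (l + s) * (s * l / (l + s) * edot u u + 1 / (l + s) * edot w w)
        = s * l * edot u u + edot w w by field; rewrite gt_eqF.
by move: h; rewrite !edotE (edotC w u); lra.
Qed.

(** Put [L = l - s] and [p = w - s u].  After multiplication by [L (1 + c L)], the
    difference of the two sides is exactly
    [(1 + c L) (L <u, p> - |p|^2) + |p - c L s u|^2]. *)
Lemma cocoercive_semimonotone s l c u w : s <= l -> 0 < 1 + c * (l - s) ->
  edot (w - s *: u) (w - s *: u) <= (l - s) * edot u (w - s *: u) ->
  s * (1 - c * s) * edot u u + c / (1 + c * (l - s)) * edot w w <= edot u w.
Proof.
rewrite le_eqVlt => /predU1P[->|sl] c0 h.
  move: h; rewrite subrr mul0r mulr0 addr0 divr1 => /edotxx_le0/eqP.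
  by rewrite subr_eq0 => /eqP ->; rewrite !edotE; lra.
set p := w - s *: u in h; have wE : w = p + s *: u by rewrite subrK.
have L0 : 0 < l - s by rewrite subr_gt0.
rewrite -(ler_pM2l c0) -(ler_pM2l L0).
set D := 1 + c * (l - s) in c0 *.
have -> : (l - s) * (D * (s * (1 - c * s) * edot u u + c / D * edot w w))
        = (l - s) * (D * (s * (1 - c * s) * edot u u) + c * edot w w).
  by field; rewrite gt_eqF.
have := edot_combo_ge0 1 (- (c * (l - s) * s)) p u.
have := ler_wpM2l (ltW c0) h.
clearbody p; rewrite wE !edotE (edotC p u) /D; lra.
Qed.

Lemma cocoercive_lipschitz s l u w :
  edot (w - s *: u) (w - s *: u) <= (l - s) * edot u (w - s *: u) ->
  edot w w <= (2 * (l - s) ^+ 2 + 2 * s ^+ 2) * edot u u.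
Proof.
set p := w - s *: u => h; have wE : w = p + s *: u by rewrite subrK.
have := edot_combo_ge0 (l - s) (- 1) u p.
have := edot_combo_ge0 1 (- s) p u.
by clearbody p; rewrite wE !edotE (edotC p u); lra.
Qed.

End SemimonotoneAlgebra.

(** * The subdifferential under curvature bounds *)

(* The extended-real inverse satisfies 0%:E^-1 = +oo, so in (v) the term
   (ell - sigma)%:E^-1 is +oo when ell = sigma. *)
Theorem proposition4p14 (R : realType) (n : nat) (n_gt0 : (0 < n)%N)
    (sigma ell : R) (f : 'rV[R]_n -> \bar R)
    (f_proper : properf f) (f_lsc : lower_semicontinuous f) :
  (* (i) *)
  (lower_curvature sigma f -> semimonotone sigma 0 (limiting_subdiff f)) /\
  (* (ii) *)
  (continuous f -> upper_curvature ell f -> ell < 0 ->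
    semimonotone 0 (1 / ell) (limiting_subdiff f)) /\
  (* (iii) *)
  (continuous f -> upper_curvature ell f -> 0 <= ell ->
    forall alpha c : R, ell < alpha -> 1 / (alpha - ell) < c ->
      semimonotone (alpha * (1 - c * alpha))
                   (parallel_sum c ((ell - alpha)%:E^-1)%E)
                   (limiting_subdiff f)) /\
  (lower_upper_curvature sigma ell f ->
    [/\ sigma <= ell,
        continuously_differentiable (fine \o f),
        (* (iv) *)
        0 < ell + sigma ->
          semimonotone (parallel_sum sigma ell%:E) (1 / (ell + sigma))
                       (fun x => [set gradient (fine \o f) x]) &
        (* (v) *)
        ell + sigma <= 0 ->
          forall c : R, 0 < 1 + c * (ell - sigma) ->
            semimonotone (sigma * (1 - c * sigma))
                         (parallel_sum c ((ell - sigma)%:E^-1)%E)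
                         (fun x => [set gradient (fine \o f) x])]).
Proof.
have fNy := f_proper.1; split; [|split; [|split]].
- move=> fs x x' y y' xy xy'; rewrite mul0r addr0 sqr_enorm.
  have fx := xy.1; have fx' := xy'.1.
  have := limiting_subdiff_lower _ _ _ _ _ fNy fs xy fx'.
  have := limiting_subdiff_lower _ _ _ _ _ fNy fs xy' fx.
  rewrite -[x' - x]opprB (edotC (x - x') (y - y')) !edotE; lra.
- move=> _ fl l0 x x' y y' xy xy'; rewrite mul0r add0r sqr_enorm.
  apply: strongly_dissipative_semimonotone => //.
  have := qsubgrad_monotone _ _ _ _ _ _ (limiting_subdiff_upper _ _ _ _ fl xy)
    (limiting_subdiff_upper _ _ _ _ fl xy').
  by rewrite -opprD edotNr; lra.
- move=> _ _ l0 alpha c la lc x x' y y' _ _.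
  have al : 0 < alpha - ell by rewrite subr_gt0.
  rewrite parallel_sum_inv ?sqr_enorm; first exact: indefinite_semimonotone.
  by move: lc; rewrite ltr_pdivrMr// => lc; apply/eqP; lra.
move=> fsl; have sl : sigma <= ell.
  apply: (@qconvex_bounds R n sigma ell (fine \o f)) => //.
    exact: lower_curvature_qconvex fsl.2.1 fsl.1.
  exact: upper_curvature_qconvex fsl.2.
have G := lower_upper_gradient _ _ _ fsl.
set g := gradient (fine \o f) in G *.
have coco x x' : let p := g x - g x' - sigma *: (x - x') in
    edot p p <= (ell - sigma) * edot (x - x') p.
  have [_ h1 h2] := G x; have [_ h1' h2'] := G x'.
  exact: (qsubgrad_cocoercive _ _ _ _ _ _ _ _ sl erefl h1 h2 h1' h2').
split=> //.
- split=> [x|]; first by have [] := G x.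
  apply: (@edot_lipschitz_continuous _ _ g
    (2 * (ell - sigma) ^+ 2 + 2 * sigma ^+ 2)) => [|x x'].
    by rewrite addr_ge0// mulr_ge0// sqr_ge0.
  by apply: cocoercive_lipschitz; exact: coco.
- move=> ls x x' _ _ -> ->; rewrite !sqr_enorm /parallel_sum/=.
  rewrite gt_eqF; last by rewrite addrC.
  by apply: cocoercive_semimonotone_pos => //; exact: coco.
- move=> _ c c0 x x' _ _ -> ->; rewrite !sqr_enorm parallel_sum_inv ?gt_eqF//.
  by apply: cocoercive_semimonotone => //; exact: coco.
Qed.
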